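(* Let $(\mathcal{C},J)$ and $(\mathcal{D},K)$ be two sites. Then: \begin{itemize} \item a functor $f:\mathcal{C}\to\mathcal{D}$ is cover-preserving from $(\mathcal{C},J)$ to $(\mathcal{D},K)$ if and only if the distributor $\mathcal{D}(1,f):\mathcal{C}\looparrowright\mathcal{D}$ is cover-distributing from $J$ to $K$; \item a functor $f:\mathcal{D}\to\mathcal{C}$ is cover-lifting from $(\mathcal{D},K)$ to $(\mathcal{C},J)$ if and only if the distributor $\mathcal{C}(f,1):\mathcal{C}\looparrowright\mathcal{D}$ is cover-distributing from $J$ to $K$. \end{itemize}
   Context: A site is a category with a Grothendieck topology. A distributor $H:\mathcal{C}\looparrowright\mathcal{D}$ is a functor $\mathcal{D}^{\mathrm{op}}\times\mathcal{C}\to\mathrm{Set}$. For $f:\mathcal{C}\to\mathcal{D}$, $\mathcal{D}(1,f)$ is the distributor $(d,c)\mapsto\mathcal{D}(d,f(c))$; for $f:\mathcal{D}\to\mathcal{C}$, $\mathcal{C}(f,1):\mathcal{C}\looparrowright\mathcal{D}$ is the distributor $(d,c)\mapsto\mathcal{C}(f(d),c)$. For a sieve $S$ on $c\in\mathcal{C}$ and $x\in H(d,c)$, $x^*H[S]$ is the sieve on $d$ of all $v:d'\to d$ such that there are $u:c'\to c$ in $S$ and $x'\in H(d',c')$ with $H(v,c)(x)=H(d',u)(x')$. $H$ is cover-distributing from $J$ to $K$ if $x^*H[S]\in K(d)$ for all $c,d$, $x\in H(d,c)$, $S\in J(c)$. A functor $f:\mathcal{C}\to\mathcal{D}$ is cover-preserving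 if for every $c$ and $S\in J(c)$ the sieve on $f(c)$ generated by $\{f(u)\mid u\in S\}$ is in $K(f(c))$. A functor $f:\mathcal{D}\to\mathcal{C}$ is cover-lifting from $(\mathcal{D},K)$ to $(\mathcal{C},J)$ if for every $d$ in $\mathcal{D}$ and $R\in J(f(d))$ the sieve $\{v:d'\to d\mid f(v)\in R\}$ is in $K(d)$. *)

(* Defs.v *)
From mathcomp Require Import ssreflect ssrfun ssrbool.
From mathcomp Require Import boolp classical_sets.

Set Implicit Arguments.
Unset Strict Implicit.
Unset Printing Implicit Defensive.

Declare Scope category_scope.
Delimit Scope category_scope with cat.
Local Open Scope classical_set_scope.
Local Open Scope category_scope.

#[local] Obligation Tactic := idtac.

Record category : Type := Category {
  ob :> Type;
  hom : ob -> ob -> Type;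
  idm : forall a, hom a a;
  comp : forall a b c, hom b c -> hom a b -> hom a c;
  comp_idl : forall a b (f : hom a b), comp (idm b) f = f;
  comp_idr : forall a b (f : hom a b), comp f (idm a) = f;
  comp_assoc : forall a b c d (h : hom c d) (g : hom b c) (f : hom a b),
    comp h (comp g f) = comp (comp h g) f
}.

Arguments hom {_} _ _.
Arguments idm {_} _.
Arguments comp {_ _ _ _} _ _.

Notation "g \o f" := (comp g f) : category_scope.

Record functor (C D : category) : Type := Functor {
  fobj :> C -> D;
  fmap : forall a b : C, hom a b -> hom (fobj a) (fobj b);
  fmap_id : forall a : C, fmap (idm a) = idm (fobj a);
  fmap_comp : forall (a b c : C) (g : hom b c) (f : hom a b),
    fmap (g \o f) = fmap g \o fmap f
}.

Arguments fmap {_ _} _ {_ _} _.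

Definition id_functor (C : category) : functor C C :=
  @Functor C C (fun c => c) (fun _ _ u => u)
    (fun=> erefl) (fun _ _ _ _ _ => erefl).

Definition opposite (C : category) : category :=
  @Category C (fun a b => @hom C b a) (@idm C) (fun _ _ _ g f => f \o g)
    (fun _ _ f => comp_idr f) (fun _ _ f => comp_idl f)
    (fun _ _ _ _ h g f => esym (comp_assoc f g h)).

Program Definition product (C D : category) : category :=
  @Category (C * D)%type
    (fun p q => (hom p.1 q.1 * hom p.2 q.2)%type)
    (fun p => (idm p.1, idm p.2))
    (fun _ _ _ g f => (g.1 \o f.1, g.2 \o f.2)) _ _ _.
Next Obligation. by move=> C D a b [f g] /=; rewrite !comp_idl. Qed.
Next Obligation. by move=> C D a b [f g] /=; rewrite !comp_idr. Qed.
Next Obligation. by move=> C D *; rewrite /= !comp_assoc. Qed.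

(* The category of sets: types and functions, with [=] as equality of elements.
   The universe of its objects is the one in which all hom-types live, so
   categories are locally small, possibly with a large type of objects. *)
Definition sets : category :=
  @Category Type (fun A B => A -> B) (fun _ x => x)
    (fun _ _ _ g f x => g (f x))
    (fun _ _ _ => erefl) (fun _ _ _ => erefl) (fun _ _ _ _ _ _ _ => erefl).

(* A distributor from C to D is contravariant in D and covariant in C. *)
Definition distributor (C D : category) : Type :=
  functor (product (opposite D) C) sets.

(* [act H v u] is the function H(v, u). *)
Definition act (C D : category) (H : distributor C D) (d d' : D) (c c' : C)
    (v : hom d' d) (u : hom c c') : H (d, c) -> H (d', c') :=
  @fmap _ _ H (d, c) (d', c') (v, u).

Arguments act {_ _} H {_ _ _ _} v u _.

Lemma act_comp (C D : category) (H : distributor C D) (d d' d'' : D)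
    (c c' c'' : C) (v : hom d' d) (v' : hom d'' d') (u : hom c c')
    (u' : hom c' c'') (x : H (d, c)) :
  act H (v \o v') (u' \o u) x = act H v' u' (act H v u x).
Proof.
exact: (congr1 (fun g => g x) (@fmap_comp _ _ H (d, c) (d', c') (d'', c'')
  (v', u') (v, u))).
Qed.

(* The distributor E(f, g), sending (d, c) to E(f(d), g(c)). *)
Program Definition hom_distributor (C D E : category)
    (f : functor D E) (g : functor C E) : distributor C D :=
  @Functor (product (opposite D) C) sets
    (fun p => @hom E (f p.1) (g p.2))
    (fun _ _ m h => fmap g m.2 \o (h \o fmap f m.1)) _ _.
Next Obligation.
by move=> *; apply: funext => h /=; rewrite !fmap_id comp_idl comp_idr.
Qed.
Next Obligation.
by move=> *; apply: funext => h /=; rewrite !fmap_comp !comp_assoc.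
Qed.

(* D(1, f) for f : C -> D. *)
Definition representable (C D : category) (f : functor C D) :
  distributor C D := hom_distributor (id_functor D) f.

(* C(f, 1) for f : D -> C. *)
Definition corepresentable (C D : category) (f : functor D C) :
  distributor C D := hom_distributor f (id_functor C).

(* Arbitrary families of arrows with codomain [c]. *)
Definition presieve (C : category) (c : C) : Type :=
  forall d : C, set (hom d c).

Record sieve (C : category) (c : C) : Type := Sieve {
  arrows :> forall d : C, set (hom d c);
  sieve_closed : forall (d e : C) (u : hom d c) (v : hom e d),
    @arrows d u -> @arrows e (u \o v)
}.

Definition maximal_sieve (C : category) (c : C) : sieve c :=
  @Sieve C c (fun=> setT) (fun _ _ _ _ => id).

Program Definition pullback_sieve (C : category) (c d : C) (u : hom d c)
    (S : sieve c) : sieve d :=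
  @Sieve C d (fun e => [set v : hom e d | S e (u \o v)]) _.
Next Obligation.
by move=> C c d u S e e' v w /= Sv; rewrite comp_assoc; apply: sieve_closed.
Qed.

Program Definition generated_sieve (C : category) (c : C) (P : presieve c) :
    sieve c :=
  @Sieve C c (fun d => [set v : hom d c |
    exists (e : C) (p : hom e c) (w : hom d e), P e p /\ v = p \o w]) _.
Next Obligation.
move=> C c P d e _ v /= [a [p [w [Pp ->]]]].
by exists a, p, (w \o v); rewrite comp_assoc.
Qed.

Record topology (C : category) : Type := Topology {
  covering :> forall c : C, set (sieve c);
  covering_maximal : forall c : C, @covering c (maximal_sieve c);
  covering_pullback : forall (c d : C) (u : hom d c) (S : sieve c),
    @covering c S -> @covering d (pullback_sieve u S);
  covering_transitive : forall (c : C) (S R : sieve c),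
    @covering c S ->
    (forall (d : C) (u : hom d c), S d u -> @covering d (pullback_sieve u R)) ->
    @covering c R
}.

(* The family of arrows f(u) for u in S; it is an inductive predicate because
   its members only have domains of the form f(c'). *)
Inductive image_presieve (C D : category) (f : functor C D) (c : C)
    (S : sieve c) : presieve (f c) :=
  ImagePresieve (c' : C) (u : hom c' c) :
    S c' u -> @image_presieve C D f c S (f c') (fmap f u).

Arguments image_presieve {C D} f {c} S _ _.

Definition cover_preserving (C D : category) (J : topology C) (K : topology D)
    (f : functor C D) : Prop :=
  forall (c : C) (S : sieve c),
    J c S -> K (f c) (generated_sieve (image_presieve f S)).

Program Definition preimage_sieve (C D : category) (f : functor D C) (d : D)
    (R : sieve (f d)) : sieve d :=
  @Sieve D d (fun d' => [set v : hom d' d | R (f d') (fmap f v)]) _.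
Next Obligation.
by move=> C D f d R a b v w /= Rv; rewrite fmap_comp; apply: sieve_closed.
Qed.

Definition cover_lifting (C D : category) (K : topology D) (J : topology C)
    (f : functor D C) : Prop :=
  forall (d : D) (R : sieve (f d)), J (f d) R -> K d (preimage_sieve R).

(* The sieve x^*H[S]. *)
Program Definition distributor_sieve (C D : category) (H : distributor C D)
    (d : D) (c : C) (x : H (d, c)) (S : sieve c) : sieve d :=
  @Sieve D d (fun d' => [set v : hom d' d |
    exists (c' : C) (u : hom c' c) (x' : H (d', c')),
      S c' u /\ act H v (idm c) x = act H (idm d') u x']) _.
Next Obligation.
move=> C D H d c x S d' d'' v w /= [c' [u [x' [Su eq_x]]]].
exists c', u, (act H w (idm c') x'); split=> //.
rewrite -[idm c](comp_idl (idm c)) act_comp eq_x -!act_comp.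
by rewrite !comp_idl !comp_idr.
Qed.

Definition cover_distributing (C D : category) (J : topology C)
    (K : topology D) (H : distributor C D) : Prop :=
  forall (c : C) (d : D) (x : H (d, c)) (S : sieve c),
    J c S -> K d (distributor_sieve x S).

(* Main.v *)
(** For [x : d -> f c], the sieve [x^*D(1,f)[S]] is the pullback along [x] of
    the sieve generated by [f(S)]; for [x : f d -> c], the sieve
    [x^*C(f,1)[S]] is the preimage under [f] of the pullback of [S] along [x].
    Stability of covering sieves under pullback then gives the implications
    from left to right, and taking [x] to be an identity gives the converses. *)
From mathcomp Require Import ssreflect ssrfun ssrbool.
From mathcomp Require Import boolp classical_sets.
Require Import Defs.

Set Implicit Arguments.
Unset Strict Implicit.
Unset Printing Implicit Defensive.

Local Open Scope category_scope.

Lemma sieve_ext (C : category) (c : C) (S R : sieve c) :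
  (forall (d : C) (u : hom d c), S d u <-> R d u) -> S = R.
Proof.
case: S R => [S clS] [R clR] /= eqSR.
have eq_arrows : S = R.
  by apply: functional_extensionality_dep => d; apply: funext => u; apply/propext.
(* Once the arrow families are identified, only two closure proofs differ, and proof irrelevance
   equates them. *)
by case: R / eq_arrows clR {eqSR} => clR; congr Sieve; apply: Prop_irrelevance.
Qed.

Lemma pullback_sieve_id (C : category) (c : C) (S : sieve c) :
  pullback_sieve (idm c) S = S.
Proof. by apply: sieve_ext => d u /=; rewrite comp_idl. Qed.

Lemma representable_sieve (C D : category) (f : functor C D) (c : C) (d : D)
    (x : hom d (f c)) (S : sieve c) :
  @distributor_sieve _ _ (representable f) d c x S =
  pullback_sieve x (generated_sieve (image_presieve f S)).
Proof.
apply: sieve_ext => d' v; split=> /=.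
- move=> [c' [u [y [Su]]]]; rewrite /act /= fmap_id comp_idl comp_idr => ->.
  by exists (f c'), (fmap f u), y.
(* [y] and [eq_xv] mention [e] and [p], so they are generalised before the case analysis turns [p]
   into some [fmap f u]. *)
- move=> [e [p [y [imp eq_xv]]]]; case: e p / imp y eq_xv => c' u Su y eq_xv.
  exists c', u, y; split=> //.
  by rewrite /act /= fmap_id comp_idl comp_idr.
Qed.

Lemma corepresentable_sieve (C D : category) (f : functor D C) (c : C) (d : D)
    (x : hom (f d) c) (S : sieve c) :
  @distributor_sieve _ _ (corepresentable f) d c x S =
  preimage_sieve (pullback_sieve x S).
Proof.
apply: sieve_ext => d' v; split=> /=.
- move=> [c' [u [y [Su]]]].
  rewrite /act /= fmap_id comp_idl comp_idr => ->.
  exact: sieve_closed.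
(* The arrow [x \o fmap f v] is itself in [S], so it factors through a member of [S] via the
   identity. *)
- move=> Sxv; exists (f d'), (x \o fmap f v), (idm (f d')); split=> //.
  by rewrite /act /= fmap_id !comp_idr comp_idl.
Qed.

Theorem proposition2p1p9 (C D : category) (J : topology C) (K : topology D) :
  (forall f : functor C D,
     cover_preserving J K f <-> cover_distributing J K (representable f)) /\
  (forall f : functor D C,
     cover_lifting K J f <-> cover_distributing J K (corepresentable f)).
Proof.
split=> f; split.
- move=> fP c d x S JS; rewrite representable_sieve.
  exact/covering_pullback/fP.
- move=> fP c S JS; have := fP c (f c) (idm (f c)) S JS.
  by rewrite representable_sieve pullback_sieve_id.
- move=> fL c d x S JS; rewrite corepresentable_sieve.
  exact/fL/covering_pullback.
- move=> fL d R JR; have := fL (f d) d (idm (f d)) R JR.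
  by rewrite corepresentable_sieve pullback_sieve_id.
Qed.
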